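(* Fix an intended semantics for the formula language, specifying which formulas are valid. Suppose that each axiom head denotes a valid schema (every instance of $\mathbf{K}$ and every instance of $\mathbf{S}$ is valid) and that Modus Ponens preserves validity (whenever $A$ and $A\to B$ are valid, $B$ is valid). Let $D=(\ell_0,\ldots,\ell_{r-1})$ be a finite derivation code. Then every line of $D$ that is accepted by the checker is valid whenever the earlier lines it cites are valid.
   Context: Fix a formula language with a binary connective $\to$ (implicational Hilbert fragment) and a primitive recursive Gödel coding of its formulas by natural numbers. The axiom heads are the schemata $\mathbf{K}$: $A\to(B\to A)$ and $\mathbf{S}$: $(A\to(B\to C))\to((A\to B)\to(A\to C))$. A proof line is a coded ordered pair $\ell=\pi_{\mathrm{CL}}(t,\varphi)$ consisting of a tag $t$ and a formula code $\varphi$; here $\pi_{\mathrm{CL}}(a,b)=\sum_i\alpha_i2^{2i}+\sum_i\beta_i2^{2i+1}$ for $a=\sum_i\alpha_i2^i$, $b=\sum_i\beta_i2^i$ in binary, an injective pairing. The tag records whether the line is to be checked as an axiom instance or by Modus Ponens (MP); an MP tag also contains two cited indices $p,q$. A derivation code is a finite sequence $D=(\ell_0,\ldots,\ell_{r-1})$ of line codes. A line is called valid if the formula coded by its formula code is valid in the fixed semantics. A line $\ell_j$ of $D$ is accepted by the checker if one of the following holds. (i) Axiom-head check: its formula code matches $\mathbf{K}$ or $\mathbf{S}$ under a uniform substitution of formula codes for the schematic letters. A line accepted this way cites no earlier lines. (ii) MP alignment: its tag is an MP tag naming indices $p,q<j$, the formula code on $\ell_q$ is the code of an implication $A\to B$,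 the formula code on $\ell_p$ is the code of $A$, and the formula code on $\ell_j$ is the code of $B$. The earlier lines cited by $\ell_j$ are then $\ell_p$ and $\ell_q$. *)

(* Defs.v *)
(* Library: MathComp *)
From mathcomp Require Import all_boot.

Set Implicit Arguments.
Unset Strict Implicit.
Unset Printing Implicit Defensive.

(* In pr_rec the recursion argument is the head of the tuple:
   f (0, v) = g v  and  f (k.+1, v) = h (k, f (k, v), v). *)
Inductive primrec : forall n : nat, (n.-tuple nat -> nat) -> Prop :=
| pr_zero : @primrec 0 (fun _ => 0)
| pr_succ : @primrec 1 (fun v => (thead v).+1)
| pr_proj n (i : 'I_n) : @primrec n (fun v => tnth v i)
| pr_comp n m (g : m.-tuple nat -> nat) (h : 'I_m -> n.-tuple nat -> nat) :
    primrec g -> (forall i, primrec (h i)) ->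
    @primrec n (fun v => g (mktuple (fun i => h i v)))
| pr_rec n (g : n.-tuple nat -> nat) (h : n.+2.-tuple nat -> nat) :
    primrec g -> primrec h ->
    @primrec n.+1 (fun v =>
      iteri (thead v) (fun k y => h [tuple of k :: y :: behead_tuple v])
        (g (behead_tuple v)))
| pr_ext n (f g : n.-tuple nat -> nat) : f =1 g -> primrec f -> primrec g.

(* Formulas other than implications are left unspecified. The last field is
   unique readability of implications. *)
Record language := Language {
  formula :> Type;
  imp : formula -> formula -> formula;
  imp_inj : forall A B A' B' : formula,
    imp A B = imp A' B' -> A = A' /\ B = B'
}.

(* The values of imp_code outside the set of formula codes are irrelevant. *)
Record godel_coding (L : language) := GodelCoding {
  code : L -> nat;
  code_inj : injective code;
  imp_code : nat -> nat -> nat;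
  imp_codeE : forall A B : L, code (imp A B) = imp_code (code A) (code B);
  imp_code_primrec :
    @primrec 2 (fun v => imp_code (tnth v ord0) (tnth v ord_max));
  code_set_primrec : exists chi : pred nat,
    @primrec 1 (fun v => nat_of_bool (chi (thead v))) /\
    (forall n, chi n <-> exists A : L, code A = n)
}.

Inductive letter := LA | LB | LC.
Inductive schema := Letter of letter | SImp of schema & schema.

Definition schema_K : schema :=
  SImp (Letter LA) (SImp (Letter LB) (Letter LA)).
Definition schema_S : schema :=
  SImp (SImp (Letter LA) (SImp (Letter LB) (Letter LC)))
       (SImp (SImp (Letter LA) (Letter LB)) (SImp (Letter LA) (Letter LC))).

Fixpoint schema_inst (L : language) (rho : letter -> L) (s : schema) : L :=
  match s with
  | Letter x => rho x
  | SImp s1 s2 => imp (schema_inst rho s1) (schema_inst rho s2)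
  end.

Fixpoint schema_code_inst (L : language) (c : godel_coding L)
    (sigma : letter -> nat) (s : schema) : nat :=
  match s with
  | Letter x => sigma x
  | SImp s1 s2 =>
      imp_code c (schema_code_inst c sigma s1) (schema_code_inst c sigma s2)
  end.

Definition is_formula_code (L : language) (c : godel_coding L) (phi : nat) :=
  exists A : L, code c A = phi.

Definition matches (L : language) (c : godel_coding L) (s : schema)
    (phi : nat) : Prop :=
  exists sigma : letter -> nat,
    (forall x, is_formula_code c (sigma x)) /\ phi = schema_code_inst c sigma s.

Definition schema_valid (L : language) (valid : L -> Prop) (s : schema) :=
  forall rho : letter -> L, valid (schema_inst rho s).

Definition MP_preserves (L : language) (valid : L -> Prop) :=
  forall A B : L, valid A -> valid (imp A B) -> valid B.

Definition bit (a i : nat) : nat := odd (a %/ 2 ^ i).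

(* Since a < 2 ^ a, all binary digits of a at positions i >= a vanish. *)
Definition pi_CL (a b : nat) : nat :=
  \sum_(i < a) bit a i * 2 ^ (2 * i) + \sum_(i < b) bit b i * 2 ^ (2 * i + 1).

Inductive ltag := AxTag | MPTag of nat & nat.

(* Below, tc is the numerical coding of tags. Since pi_CL is injective, the
   tag and the formula code of a line are unique when tc is injective. *)
Definition line_tag (tc : ltag -> nat) (ell : nat) (t : ltag) : Prop :=
  exists phi, ell = pi_CL (tc t) phi.

Definition line_fcode (tc : ltag -> nat) (ell phi : nat) : Prop :=
  exists t, ell = pi_CL (tc t) phi.

Definition is_line (L : language) (c : godel_coding L) (tc : ltag -> nat)
    (ell : nat) : Prop :=
  exists t phi, is_formula_code c phi /\ ell = pi_CL (tc t) phi.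

Definition derivation_code (L : language) (c : godel_coding L)
    (tc : ltag -> nat) (D : seq nat) : Prop :=
  forall j, j < size D -> is_line c tc (nth 0 D j).

Definition line_valid (L : language) (c : godel_coding L) (tc : ltag -> nat)
    (valid : L -> Prop) (ell : nat) : Prop :=
  exists A : L, line_fcode tc ell (code c A) /\ valid A.

(* [accepted c tc D j cited]: line j passes the checker, citing the lines whose
   indices are listed in cited. The citations belong to the clause used, as a
   line with an MP tag may also pass the axiom-head check, which does not look
   at the tag. *)
Inductive accepted (L : language) (c : godel_coding L) (tc : ltag -> nat)
    (D : seq nat) (j : nat) : seq nat -> Prop :=
| accept_axiom phi :
    line_fcode tc (nth 0 D j) phi ->
    matches c schema_K phi \/ matches c schema_S phi ->
    accepted c tc D j [::]
| accept_MP p q (A B : L) :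
    line_tag tc (nth 0 D j) (MPTag p q) -> p < j -> q < j ->
    line_fcode tc (nth 0 D q) (code c (imp A B)) ->
    line_fcode tc (nth 0 D p) (code c A) ->
    line_fcode tc (nth 0 D j) (code c B) ->
    accepted c tc D j [:: p; q].

(* Main.v *)
(* Peeling off the two lowest binary digits of [pi_CL a b] recovers those of [a]
   and [b], so [pi_CL] is injective and each line carries a unique formula code.
   Since [code] is injective, the codes on the cited lines determine the formulas
   that were assumed valid, and validity of the schemata and of Modus Ponens
   applies to them. *)

Require Import Defs.
From mathcomp Require Import all_boot.
From mathcomp Require Import zify.

Lemma bit0 a : bit a 0 = odd a.
Proof. by rewrite /bit expn0 divn1. Qed.

Lemma bitS a i : bit a i.+1 = bit a./2 i.
Proof. by rewrite /bit expnS divnMA divn2. Qed.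

Lemma bit_small a i : a <= i -> bit a i = 0.
Proof.
move=> le_ai; rewrite /bit divn_small //.
exact: leq_ltn_trans le_ai (ltn_expl i (ltnSn 1)).
Qed.

(** The added terms are zero digits. Each sum in [pi_CL] is bounded by the number itself, so halving
    that number forces a change of range. *)
Lemma bit_sum_widen (w : nat -> nat) a n : a <= n ->
  \sum_(i < n) bit a i * w i = \sum_(i < a) bit a i * w i.
Proof.
move=> le_an; rewrite -!(big_mkord xpredT (fun i => bit a i * w i)).
rewrite (big_cat_nat (leq0n a) le_an) /= [X in _ + X]big_nat_cond.
rewrite [X in _ + X]big1 ?addn0 // => i /andP[/andP[le_ai _] _].
by rewrite bit_small.
Qed.

Lemma bit_sum_half (w : nat -> nat) a :
  \sum_(i < a) bit a i * w i =
  odd a * w 0 + \sum_(i < a./2) bit a./2 i * w i.+1.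
Proof.
(* Range [a.+1] is nonempty even for [a = 0], so the lowest digit can always be split off. *)
rewrite -(bit_sum_widen w _ _ (leqnSn a)) big_ord_recl bit0; congr (_ + _).
rewrite -(bit_sum_widen (fun i => w i.+1) _ a); last by lia.
by apply: eq_bigr => i _; rewrite bitS.
Qed.

(** Interleaving makes [odd a + 2 * odd b] the lowest base-4 digit; the higher digits interleave the
    halves. *)
Lemma pi_CL_half a b :
  pi_CL a b = odd a + 2 * odd b + 4 * pi_CL a./2 b./2.
Proof.
rewrite /pi_CL (bit_sum_half (fun i => 2 ^ (2 * i)) a).
rewrite (bit_sum_half (fun i => 2 ^ (2 * i + 1)) b) mulnDr !big_distrr /=.
(* Used with [k = 0] for the even positions and [k = 1] for the odd ones. *)
have quad (x i k : nat) : x * 2 ^ (2 * i.+1 + k) = 4 * (x * 2 ^ (2 * i + k)).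
  by rewrite mulnS -addnA expnD mulnCA.
under eq_bigr => i _ do rewrite -[2 * i.+1]addn0 quad addn0.
under [X in _ + (_ + X)]eq_bigr => i _ do rewrite quad.
by rewrite muln0 add0n expn0 expn1; lia.
Qed.

Lemma pi_CL_inj a b a' b' : pi_CL a b = pi_CL a' b' -> a = a' /\ b = b'.
Proof.
have [n] := ubnP (a + b + a' + b').
elim: n a b a' b' => // n IHn a b a' b' lt_n eq_pi.
(* Halving strictly lowers the sum of the four numbers unless all are zero. *)
have [zero|nonzero] := posnP (a + b + a' + b'); first by lia.
have := eq_pi; rewrite (pi_CL_half a b) (pi_CL_half a' b') => eq_half.
(* Each side of [eq_half] is a remainder below 4 plus a multiple of 4, so parities and quotients
   agree separately. *)
have [||eq_a eq_b] := IHn a./2 b./2 a'./2 b'./2; lia.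
Qed.

Lemma line_fcode_inj tc ell phi psi :
  line_fcode tc ell phi -> line_fcode tc ell psi -> phi = psi.
Proof. by move=> [t ->] [u /pi_CL_inj[]]. Qed.

Lemma line_valid_fcode (L : language) (c : godel_coding L) tc
    (valid : L -> Prop) ell (A : L) :
  line_fcode tc ell (code c A) -> line_valid c tc valid ell -> valid A.
Proof.
by move=> ellA [B [ellB vB]]; rewrite (code_inj (line_fcode_inj _ _ _ _ ellA ellB)).
Qed.

Lemma code_schema_inst (L : language) (c : godel_coding L)
    (rho : letter -> L) (sigma : letter -> nat) (s : schema) :
  (forall x, code c (rho x) = sigma x) ->
  code c (schema_inst rho s) = schema_code_inst c sigma s.
Proof.
by move=> rhoE; elim: s => [x|s1 IH1 s2 IH2] /=; rewrite ?imp_codeE ?IH1 ?IH2.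
Qed.

(** Decoding [sigma] at the three letters yields a substitution [rho] of formulas, whose instance
    has code [phi]. *)
Lemma matches_valid (L : language) (c : godel_coding L)
    (valid : L -> Prop) (s : schema) phi :
  schema_valid valid s -> matches c s phi ->
  exists A : L, code c A = phi /\ valid A.
Proof.
move=> s_valid [sigma [sigma_code ->]].
have [A codeA] := sigma_code LA.
have [B codeB] := sigma_code LB.
have [C codeC] := sigma_code LC.
pose rho x := match x with LA => A | LB => B | LC => C end.
exists (schema_inst rho s); split; last exact: s_valid.
by apply: code_schema_inst; case.
Qed.

Theorem proposition4p2p1 (L : language) (c : godel_coding L)
    (tc : ltag -> nat) (tc_inj : injective tc)
    (valid : L -> Prop)
    (K_valid : schema_valid valid schema_K)
    (S_valid : schema_valid valid schema_S)
    (MP_valid : MP_preserves valid)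
    (D : seq nat) (D_der : derivation_code c tc D)
    (j : nat) (j_lt : j < size D)
    (cited : seq nat) (acc : accepted c tc D j cited)
    (cited_valid : forall i, i \in cited ->
       line_valid c tc valid (nth 0 D i)) :
  line_valid c tc valid (nth 0 D j).
Proof.
case: acc cited_valid => [phi jphi match_phi _|p q A B _ _ _ qAB pA jB cited_valid].
  have [A [codeA vA]] : exists A : L, code c A = phi /\ valid A.
    by case: match_phi; apply: matches_valid.
  by exists A; rewrite codeA.
(* Validity of a cited line speaks of some formula on it; [line_valid_fcode] identifies that formula
   with [A] or [imp A B]. *)
exists B; split=> //; apply: (MP_valid A).
  by apply: line_valid_fcode pA (cited_valid p _); rewrite mem_head.
by apply: line_valid_fcode qAB (cited_valid q _); rewrite !inE eqxx orbT.
Qed.
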